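(* Let $R$ be a tolerance induced by an irredundant covering of $U$. The complete lattices $\wp(U)^{\blacktriangledown}$ and $\wp(U)^{\blacktriangle}$ are atomistic Boolean lattices such that $\{R(x)^{\blacktriangledown}\mid x \in U,\ R(x)\text{ is a block of } R\}$ and $\{R(x)\mid x\in U,\ R(x)\text{ is a block of }R\}$ are their sets of atoms, respectively.
   Context: A tolerance on $U$ is a reflexive and symmetric binary relation $R$ on $U$; $R(x)=\{y\in U\mid x\,R\,y\}$. For $X\subseteq U$, $X^{\blacktriangledown}=\{x\in U\mid R(x)\subseteq X\}$ and $X^{\blacktriangle}=\{x\in U\mid R(x)\cap X\neq\emptyset\}$. $\wp(U)^{\blacktriangledown}=\{X^{\blacktriangledown}\mid X\subseteq U\}$ and $\wp(U)^{\blacktriangle}=\{X^{\blacktriangle}\mid X\subseteq U\}$ are ordered by inclusion and are complete lattices. A covering of $U$ is a collection $\mathcal{H}$ of nonempty subsets of $U$ with $\bigcup\mathcal{H}=U$; it is irredundant if $\mathcal{H}\setminus\{X\}$ is not a covering of $U$ for any $X\in\mathcal{H}$. The tolerance induced by a covering $\mathcal{H}$ is $R_{\mathcal{H}}=\bigcup\{X\times X\mid X\in\mathcal{H}\}$. A preblock of $R$ is a set $X\subseteq U$ with $X\times X\subseteq R$; a block of $R$ is a maximal (with respect to inclusion) preblock. A lattice with least element $0$ is atomistic if every element is the join of the atoms below it. *)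

(* Defs.v *)
From HB Require Import structures.
From mathcomp Require Import all_boot all_order.
From mathcomp Require Import boolp classical_sets.
Set Implicit Arguments.
Unset Strict Implicit.
Unset Printing Implicit Defensive.

Local Open Scope classical_set_scope.
Local Open Scope order_scope.

Section OrderNotions.
Context {d : Order.disp_t}.
Implicit Type P : porderType d.

Definition complete_lattice P : Prop :=
  forall A : set P, supremums A !=set0 /\ infimums A !=set0.

(* All the lattice operations are determined by the order, so being Boolean is
   a property of the poset: it underlies a complemented distributive lattice
   with bottom and top. *)
Definition boolean_lattice P : Prop :=
  exists B : ctbDistrLatticeType d, B = P :> porderType d.

Definition covers P (x y : P) : Prop :=
  x < y /\ forall z : P, ~ (x < z < y).

Definition atoms P : set P :=
  [set a | exists2 o, lbound [set: P] o & covers o a].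

Definition atomistic P : Prop :=
  forall x : P, supremums [set a | atoms a /\ a <= x] x.

End OrderNotions.
Arguments atoms {d} P.

(* The poset of the members of [L], ordered by inclusion. *)
Definition set_poset {U : Type} (L : set (set U)) : Type := set_type L.

HB.instance Definition _ (U : Type) (L : set (set U)) :=
  SubChoice.on (set_poset L).
HB.instance Definition _ (U : Type) (L : set (set U)) :=
  [SubChoice_isSubPOrder of set_poset L by <: with set_display].

Section Tolerances.
Context {U : Type}.
Implicit Types (R : set (U * U)) (X : set U) (H : set (set U)).

Definition tolerance R : Prop :=
  (forall x, R (x, x)) /\ (forall x y, R (x, y) -> R (y, x)).

(* [xsection R x] is the neighbourhood R(x). *)
Definition lower R X : set U := [set x | xsection R x `<=` X].
Definition upper R X : set U := [set x | xsection R x `&` X !=set0].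

Definition lower_sets R : set (set U) := range (lower R).
Definition upper_sets R : set (set U) := range (upper R).

Definition covering H : Prop :=
  (forall X, H X -> X !=set0) /\ \bigcup_(X in H) X = [set: U].

Definition irredundant_covering H : Prop :=
  covering H /\ forall X, H X -> ~ covering (H `\ X).

Definition induced_tolerance H : set (U * U) := \bigcup_(X in H) (X `*` X).

Definition preblock R X : Prop := X `*` X `<=` R.

Definition block R X : Prop :=
  preblock R X /\ forall Y, preblock R Y -> X `<=` Y -> Y = X.

End Tolerances.

(* Main.v *)
Require Import Defs.
From HB Require Import structures.
From mathcomp Require Import all_boot all_order.
From mathcomp Require Import boolp classical_sets.
Local Open Scope classical_set_scope.

(** Each member [X] of the irredundant covering [H] has a point that lies in no
    other member; the neighbourhood of such a point is [X] itself, which makes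
    [X] a block, and conversely every neighbourhood that is a block belongs to
    [H].  Sending a subfamily [S] of [H] to its union identifies the powerset
    of [H] with the upper sets, and sending [S] to the set of the points all of
    whose covering members lie in [S] identifies it with the lower sets; the
    private points make both maps order embeddings.  So both posets are
    isomorphic to a powerset, with atoms the images of the singletons. *)

Import Order.TTheory.

Section PowersetIso.
Context {d : Order.disp_t} {P : porderType d} {I : Type} (f : set I -> P).
Context (f_surj : forall p, exists A, f A = p).
Context (f_le : forall A B, (f A <= f B)%O <-> A `<=` B).

Let f_lt A B : (f A < f B)%O <-> A `<` B.
Proof.
rewrite lt_leAnge; split=> [/andP[/f_le AB /negP nBA]|[AB nBA]].
  by split=> // /f_le.
by apply/andP; split; [exact/f_le | apply/negP => /f_le].
Qed.

Lemma powerset_iso_complete : complete_lattice P.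
Proof.
move=> X; split.
- exists (f (\bigcup_(A in f @^-1` X) A)); split=> [p | p ub_p].
  + by have [A <-] := f_surj p => XA; apply/f_le => i Ai; exists A.
  + have [B fB] := f_surj p; rewrite -fB; apply/f_le => i [A XA Ai].
    by have := ub_p _ XA; rewrite -fB => /f_le; apply.
- exists (f (\bigcap_(A in f @^-1` X) A)); split=> [p | p lb_p].
  + by have [A <-] := f_surj p => XA; apply/f_le => i; apply.
  + have [B fB] := f_surj p; rewrite -fB; apply/f_le => i Bi A XA.
    by have := lb_p _ XA; rewrite -fB => /f_le; apply.
Qed.

Lemma powerset_iso_atoms : atoms P = [set f [set i] | i in [set: I]].
Proof.
apply/seteqP; split=> [a | _ [i _ <-]].
  case=> o o_min [oa o_max].
  have [O fO] := f_surj o; have [A fA] := f_surj a; subst o a.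
  have O0 : O = set0 by rewrite -subset0; apply/f_le/o_min.
  have [_ /existsNP[i /not_implyP[Ai _]]] := (f_lt _ _).1 oa.
  exists i => //; congr f; apply/seteqP; split=> [_ -> // | j Aj].
  (* A second point [j] of [A] would put [f [set i]] strictly between the bottom [f set0] and
     [f A]. *)
  apply: contrapT => nij; apply: (o_max (f [set i])).
  apply/andP; split; apply/f_lt; rewrite ?O0; split=> //.
  - by move=> /(_ i erefl).
  - by move=> _ ->.
  - by move=> /(_ j Aj).
exists (f set0) => [p _ | ]; first by have [A <-] := f_surj p; apply/f_le.
split=> [ | p]; first by apply/f_lt; split=> // /(_ i erefl).
have [A <-] := f_surj p => /andP[/f_lt[_ nA0] /f_lt[Ai]]; apply=> _ ->.
have /existsNP[j /not_implyP[Aj _]] := nA0.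
by rewrite -(Ai _ Aj).
Qed.

Lemma powerset_iso_atomistic : atomistic P.
Proof.
move=> p; have [A <-] := f_surj p; rewrite powerset_iso_atoms.
split=> [_ [_ ] // | q ub_q].
have [B fB] := f_surj q; rewrite -fB; apply/f_le => i Ai.
have : (f [set i] <= q)%O by apply: ub_q; split; [exists i | apply/f_le => _ ->].
by rewrite -fB => /f_le; apply.
Qed.

End PowersetIso.

(** Union, intersection and complement are transported along [f] and its inverse [g]. The lattice is
    built on top of the given order of [P], so the required equality of posets holds by
    reflexivity. *)
Lemma powerset_iso_boolean {d : Order.disp_t} {P : porderType d} {I : Type}
    (f : set I -> P) :
    (forall p, exists A, f A = p) ->
    (forall A B, (f A <= f B)%O <-> A `<=` B) ->
  boolean_lattice P.
Proof.
(* [P] is destructed because the [Build] and [HB.pack] unifications need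
   [P] to be [Pack (sort P) _], which fails for a variable (no eta). *)
case: P f => T c; set P := Order.POrder.Pack c => f f_surj f_le.
have [g gK] := choice f_surj.
have fK : cancel f g.
  by move=> A; apply/seteqP; split; apply/f_le; rewrite gK.
have g_mono : {mono g : p q / (p <= q)%O}.
  move=> p q; apply/idP/idP; rewrite subsetEset => pq.
    by rewrite -(gK p) -(gK q); apply/f_le.
  by apply/f_le; rewrite !gK.
pose LD := Order.IsoDistrLattice.Build d P gK fK g_mono.
pose L : distrLatticeType d := HB.pack T P LD.
have f0 p : (f set0 <= p)%O by rewrite -(gK p); apply/f_le.
have fT p : (p <= f setT)%O by rewrite -(gK p); apply/f_le.
pose BD := Order.hasBottom.Build d L f0.
pose TD := Order.hasTop.Build d L fT.
pose TB : tbDistrLatticeType d := HB.pack T L BD TD.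
have joinE (p q : TB) : Order.join p q = f (g p `|` g q) by [].
have meetE (p q : TB) : Order.meet p q = f (g p `&` g q) by [].
have joinC (p : TB) : Order.join p (f (~` g p)) = Order.top.
  by rewrite joinE fK setUv.
have meetC (p : TB) : Order.meet p (f (~` g p)) = Order.bottom.
  by rewrite meetE fK setICr.
pose CD := Order.TBDistrLattice_hasComplement.Build d TB joinC meetC.
pose C : ctbDistrLatticeType d := HB.pack T TB CD.
by exists C; reflexivity.
Qed.

Lemma range_poset_boolean {U I : Type} {L : set (set U)} (F : set I -> set U) :
    L = range F -> (forall A B, F A `<=` F B <-> A `<=` B) ->
  [/\ complete_lattice (set_poset L), boolean_lattice (set_poset L),
      atomistic (set_poset L) &
      [set \val a | a in atoms (set_poset L)] = range (fun i => F [set i])].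
Proof.
move=> LE F_le; have LF A : F A \in L by rewrite LE; apply/mem_set; exists A.
pose f A : set_poset L := exist _ (F A) (LF A).
have f_surj p : exists A, f A = p.
  have [A _ FA] : range F (val p) by rewrite -LE; exact/set_mem/valP.
  by exists A; apply: val_inj.
have f_le A B : (f A <= f B)%O <-> A `<=` B.
  by rewrite -Order.le_val subsetEset; exact: F_le.
split; [exact: powerset_iso_complete f f_surj f_le
       | exact: powerset_iso_boolean f f_surj f_le
       | exact: powerset_iso_atomistic f f_surj f_le | ].
rewrite (powerset_iso_atoms f f_surj f_le).
apply/seteqP; split=> [_ [_ [i _ <-] <-] | _ [i _ <-]]; first by exists i.
by exists (f [set i]) => //; exists i.
Qed.

Section IrredundantCovering.
Context {U : Type} {R : set (U * U)} {H : set (set U)}.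
Context (irrH : irredundant_covering H) (RE : R = induced_tolerance H).

Let cover_point x : exists2 X, H X & X x.
Proof. by have : [set: U] x := I; rewrite -irrH.1.2. Qed.

Let nbhdP x y : xsection R x y <-> exists X, [/\ H X, X x & X y].
Proof.
rewrite xsectionP RE; split=> [[X HX [/= Xx Xy]] | [X [HX Xx Xy]]].
  by exists X.
by exists X.
Qed.

(** If each point of [X] lay in another member, removing [X] would leave a covering. *)
Lemma irredundant_private_point X : H X ->
  exists2 x, X x & forall Y, H Y -> Y x -> Y = X.
Proof.
move=> HX; apply: contrapT => noX; apply: (irrH.2 X HX).
split=> [Y [HY _]|]; first exact: irrH.1.1.
rewrite -subTset => x _; have [Y HY Yx] := cover_point x.
have [YX | nYX] := pselect (Y = X); last by exists Y.
apply: contrapT => nox; apply: noX; exists x; first by rewrite -YX.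
by move=> Z HZ Zx; apply: contrapT => ZX; apply: nox; exists Z.
Qed.

Let private_nbhd X x : H X -> X x -> (forall Y, H Y -> Y x -> Y = X) ->
  xsection R x = X.
Proof.
move=> HX Xx x_priv; apply/seteqP; split=> [y /nbhdP[Y [HY Yx Yy]] | y Xy].
  by rewrite -(x_priv Y).
by apply/nbhdP; exists X.
Qed.

(** A preblock lies in the neighbourhood of each of its points. If R(x) is a preblock and [X] is a
    member containing x, then R(x) contains a private point y of [X], so R(x) lies in R(y), which is
    [X]; the reverse inclusion holds since [X] is a preblock. Conversely, a preblock containing [X]
    contains a private point of [X], hence lies in [X]. *)
Lemma block_nbhd_covering :
  [set xsection R x | x in [set x | block R (xsection R x)]] = H.
Proof.
have preH X : H X -> preblock R X.
  by move=> HX [x y] [/= Xx Xy]; rewrite RE; exists X.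
have preblock_nbhd X x : preblock R X -> X x -> X `<=` xsection R x.
  by move=> pX Xx y Xy; apply/xsectionP/pX.
apply/seteqP; split=> [_ [x [pRx _] <-] | X HX].
  have [X HX Xx] := cover_point x.
  have [y Xy y_priv] := irredundant_private_point X HX.
  suff -> : xsection R x = X by [].
  apply/seteqP; split; last exact: preblock_nbhd (preH X HX) Xx.
  rewrite -(private_nbhd X y HX Xy y_priv); apply: preblock_nbhd => //.
  by apply/nbhdP; exists X.
have [x Xx x_priv] := irredundant_private_point X HX.
have RxX := private_nbhd X x HX Xx x_priv.
exists x => //=; rewrite RxX; split=> [|Y pY sXY]; first exact: preH.
apply/seteqP; split=> //; rewrite -RxX; apply: preblock_nbhd => //.
exact: sXY.
Qed.

(** Both order embeddings are tested at private points, where a point determines its member. *)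
Let private_family_sub (A B : set (set_type H)) :
  (forall X x, A X -> val X x -> (forall Y, H Y -> Y x -> Y = val X) -> B X) ->
  A `<=` B.
Proof.
move=> AB X AX; have [x Xx x_priv] := irredundant_private_point _ (set_mem (valP X)).
exact: AB AX Xx x_priv.
Qed.

Lemma upper_sets_range :
  upper_sets R = range (fun A : set (set_type H) => \bigcup_(X in A) val X).
Proof.
apply/seteqP; split=> [_ [Y _ <-] | _ [A _ <-]].
- exists [set X | val X `&` Y !=set0] => //; apply/seteqP; split=> x.
  + move=> [X [y [Xy Yy]] Xx]; exists y; split=> //; apply/nbhdP; exists (val X).
    by split=> //; exact: set_mem (valP X).
  + move=> [y [/nbhdP[X [HX Xx Xy]] Yy]].
    by exists (exist _ X (mem_set HX)) => //; exists y.
(* The union over [A] is the upper set of the points whose neighbourhood is a member of [A]; private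
   points ensure that each member of [A] is such a neighbourhood. *)
- exists [set x | exists2 X, A X & xsection R x = val X] => //.
  apply/seteqP; split=> x.
  + move=> [y [xy [X AX Ry]]]; exists X => //; rewrite -Ry.
    by apply/nbhdP; have /nbhdP[Z [HZ Zx Zy]] := xy; exists Z.
  + move=> [X AX Xx].
    have [y Xy y_priv] := irredundant_private_point _ (set_mem (valP X)).
    exists y; split; last first.
      by exists X => //; apply: private_nbhd => //; exact: set_mem (valP X).
    by apply/nbhdP; exists (val X); split=> //; exact: set_mem (valP X).
Qed.

Lemma upper_family_le (A B : set (set_type H)) :
  \bigcup_(X in A) val X `<=` \bigcup_(X in B) val X <-> A `<=` B.
Proof.
split=> [AB | AB x [X AX Xx]]; last by exists X => //; apply: AB.
apply: private_family_sub => X x AX Xx x_priv.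
have [Y BY Yx] := AB x (ex_intro2 _ _ X AX Xx).
suff <- : Y = X by [].
by apply/val_inj/x_priv => //; exact: set_mem (valP Y).
Qed.

(** This is the complement of the union of the members outside [A], the De Morgan dual of the map
    used for the upper sets. *)
Definition lower_family (A : set (set_type H)) : set U :=
  [set x | forall X, val X x -> A X].

Lemma lower_sets_range : lower_sets R = range lower_family.
Proof.
apply/seteqP; split=> [_ [Y _ <-] | _ [A _ <-]].
- exists [set X | val X `<=` Y] => //; apply/seteqP; split=> x Yx.
  + by move=> y /nbhdP[X [HX Xx Xy]]; apply: (Yx (exist _ X (mem_set HX))).
  + move=> X Xx y Xy; apply: Yx; apply/nbhdP; exists (val X).
    by split=> //; exact: set_mem (valP X).
(* If R(x) lies in this union, so does a private point of any member [X] containing x, which forces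
   [X] into [A]. *)
- exists (\bigcup_(X in A) val X) => //; apply/seteqP; split=> x Ax.
  + move=> X Xx.
    have [y Xy y_priv] := irredundant_private_point _ (set_mem (valP X)).
    have [|Y AY Yy] := Ax y.
      by apply/nbhdP; exists (val X); split=> //; exact: set_mem (valP X).
    suff <- : Y = X by [].
    by apply/val_inj/y_priv => //; exact: set_mem (valP Y).
  + move=> y /nbhdP[X [HX Xx Xy]].
    by exists (exist _ X (mem_set HX)) => //; apply: Ax.
Qed.

Lemma lower_family_le (A B : set (set_type H)) :
  lower_family A `<=` lower_family B <-> A `<=` B.
Proof.
split=> [AB | AB x Ax X Xx]; last exact/AB/Ax.
apply: private_family_sub => X x AX Xx x_priv.
apply: (AB x) => // Y Yx; suff -> : Y = X by [].
by apply/val_inj/x_priv => //; exact: set_mem (valP Y).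
Qed.

(** This puts the atoms in the required form. If R(x) lies in [X] and [Y] is a member containing x,
    a private point of [Y] lies in R(x), hence in [X], so [X] is [Y]. *)
Lemma lower_family1 (X : set_type H) : lower_family [set X] = lower R (val X).
Proof.
have HX := set_mem (valP X).
apply/seteqP; split=> x /= => [x_priv y /nbhdP[Y [HY Yx Yy]] | Rx Y Yx].
  by rewrite -(x_priv (exist _ Y (mem_set HY)) Yx).
have HY := set_mem (valP Y).
have [y Yy y_priv] := irredundant_private_point _ HY.
apply/esym/val_inj/y_priv => //; apply: Rx.
by apply/nbhdP; exists (val Y).
Qed.

End IrredundantCovering.

Theorem proposition3p9 (U : Type) (R : set (U * U)) (H : set (set U))
    (tolR : tolerance R) (irrH : irredundant_covering H)
    (RE : R = induced_tolerance H) :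
  [/\ complete_lattice (set_poset (lower_sets R)),
      boolean_lattice (set_poset (lower_sets R)),
      atomistic (set_poset (lower_sets R)) &
      [set \val a | a in atoms (set_poset (lower_sets R))] =
        [set lower R (xsection R x) | x in [set x | block R (xsection R x)]]]
  /\
  [/\ complete_lattice (set_poset (upper_sets R)),
      boolean_lattice (set_poset (upper_sets R)),
      atomistic (set_poset (upper_sets R)) &
      [set \val a | a in atoms (set_poset (upper_sets R))] =
        [set xsection R x | x in [set x | block R (xsection R x)]]].
Proof.
split.
- have [? ? ? ->] :=
    range_poset_boolean _ (lower_sets_range irrH RE) (lower_family_le irrH).
  (* Factoring the image through the block neighbourhoods turns the claimed atoms into the sets
     [lower R X] for [X] in [H]. *)
  split=> //; rewrite -(image_comp (xsection R)) (block_nbhd_covering irrH RE).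
  apply/seteqP; split=> [_ [X _ <-] | _ [X HX <-]].
    by exists (val X); [exact: set_mem (valP X) | rewrite (lower_family1 irrH RE)].
  by exists (exist _ X (mem_set HX)); rewrite // (lower_family1 irrH RE).
- have [? ? ? ->] :=
    range_poset_boolean _ (upper_sets_range irrH RE) (upper_family_le irrH).
  split=> //; rewrite (block_nbhd_covering irrH RE).
  apply/seteqP; split=> [_ [X _ <-] | X HX].
    by rewrite bigcup_set1; exact: set_mem (valP X).
  by exists (exist _ X (mem_set HX)); rewrite // bigcup_set1.
Qed.
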